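(* Let $q$ be a power of a prime. For any multiplicative characters $A,A',B,B',C$ of $\mathbb{F}_q^*$, any $y,t\in\mathbb{F}_q^*\setminus\{1\}$ and any $x\in\mathbb{F}_q$, \begin{align*} &\frac{1}{q-1}\sum_{\theta}\binom{BB'\overline{C}\theta}{\theta}F_{3}(A,A';B,B'\theta;C;x,y)\,\theta(t)\\ &=\overline{B'}(1-t)\,F_{3}\left(A,A';B,B';C;x,\frac{y}{1-t}\right)+\overline{B}\,\overline{B'}C(-t)\,F_{3}(A,A';B,C\overline{B};C;x,y)\\ &\quad-\overline{B}(x)\,\overline{B'}(-t)\,\overline{C}B\left(-\frac{y}{t}\right)\binom{\overline{A'}}{\overline{C}B}\binom{\overline{A}}{\overline{B}}, \end{align*} where the sum is over all multiplicative characters $\theta$ of $\mathbb{F}_q^*$.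
   Context: $\mathbb{F}_q$ is the finite field with $q$ elements. Characters are complex-valued multiplicative characters of $\mathbb{F}_q^*$; every character $\chi$, including the trivial character $\varepsilon$, is extended to $\mathbb{F}_q$ by $\chi(0)=0$. $\overline{\chi}$ is the inverse of $\chi$; juxtaposition of characters is their product, so that e.g. $\overline{B}\,\overline{B'}C(-t)$ means $(\overline{B}\,\overline{B'}C)(-t)$. For characters $\chi,\lambda$ the Jacobi sum is $J(\chi,\lambda)=\sum_{u\in\mathbb{F}_q}\chi(u)\lambda(1-u)$, and the binomial coefficient of characters $A,B$ is $\binom{A}{B}=B(-1)J(A,\overline{B})$ (no factor $1/q$). The finite field Appell series $F_3$ is, for characters $A,A',B,B',C$ and $x,y\in\mathbb{F}_q$, $$F_{3}(A,A';B,B';C;x,y)=\varepsilon(xy)\,BB'(-1)\sum_{u,v\in\mathbb{F}_q}B(u)\,B'(v)\,C\overline{B}\,\overline{B'}(1-u-v)\,\overline{A}(1-ux)\,\overline{A'}(1-vy).$$ *)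

(* Defs.v *)
From HB Require Import structures.
From mathcomp Require Import all_boot all_order all_fingroup all_algebra.
From mathcomp Require Import all_solvable all_field all_character.

Set Implicit Arguments.
Unset Strict Implicit.
Unset Printing Implicit Defensive.

Import GRing.Theory Num.Theory.
Local Open Scope ring_scope.

(* The group F^*.  Its multiplicative characters are the linear characters
   [chi : 'CF(unitsG F)], [chi \is a linear_char]; they take values in [algC],
   which loses nothing since the values of a character of a finite abelian group
   are roots of unity.  Product, inverse and the trivial character are the ring
   operations [*], [^-1] and [1] of ['CF(unitsG F)].  A sum over all characters
   ranges over the linear entries of [irr (unitsG F)]: this tuple has no
   repetitions and contains every linear character ([lin_char_irr]). *)
Definition unitsG (F : finFieldType) : {group {unit F}} := [set: {unit F}]%G.

(* [insub x] is [Some u] with [val u = x] when [x] is nonzero, and [None] when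
   [x = 0]; in particular the trivial character also vanishes at 0. *)
Definition ext (F : finFieldType) (chi : 'CF(unitsG F)) (x : F) : algC :=
  if insub x is Some u then chi u else 0.

Definition jacobi (F : finFieldType) (chi lambda : 'CF(unitsG F)) : algC :=
  \sum_(u : F) ext chi u * ext lambda (1 - u).

(* Not normalised: there is no factor [1 / #|F|]. *)
Definition cbinom (F : finFieldType) (A B : 'CF(unitsG F)) : algC :=
  ext B (-1) * jacobi A B^-1.

Definition appellF3 (F : finFieldType) (A A' B B' C : 'CF(unitsG F)) (x y : F)
    : algC :=
  ext 1 (x * y) * ext (B * B') (-1) *
  \sum_(u : F) \sum_(v : F)
     ext B u * ext B' v * ext (C * B^-1 * B'^-1) (1 - u - v) *
     ext A^-1 (1 - u * x) * ext A'^-1 (1 - v * y).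

(* Main.v *)
Require Import Defs.
From mathcomp Require Import all_boot all_order all_fingroup all_algebra.
From mathcomp Require Import all_solvable all_field all_character.
From mathcomp Require Import ring.
Import GRing.Theory Num.Theory.
Local Open Scope ring_scope.

(** The sum over [theta] is carried out by the finite field binomial theorem: the
average over all characters [theta] of [cbinom (D * theta) theta * ext theta z] is
[ext D^-1 (1 - z)] for [z] nonzero, and 0 at [z = 0] ([binomial_theorem]).
That theorem is just orthogonality of characters: expanding the Jacobi sum, the
sum over [theta] selects the only [w] with [w * (1 - z) = 1].

In the double sum over [u] and [v] defining the Appell series with parameter
[B' * theta], the character [theta] occurs only as
[ext theta (v / (1 - u - v))], and the prefactor contributes [ext theta (-1)]
([appellF3_mul_ext]).  With [D = B * B' * C^-1],
the binomial theorem at [z = - v * t / (1 - u - v)] turns the factor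
[ext D^-1 (1 - u - v)] into [ext D^-1 (1 - u - v * (1 - t))], except on the line
[u + v = 1], where the original summand vanishes and the new one need not.  So
the left-hand side is a full double sum minus a sum over that line
([sum_binom_appellF3]).

The substitution of [v * (1 - t)] for [v] identifies the full double sum with
the first term on the right ([appellF3_scale]).  For the sum over the line, take
[B' = C * B^-1] in the Appell series: the character of [1 - u - v] becomes
trivial, i.e. it is the indicator of the complement of the line.  Hence that
series is a product of two single sums, each a Jacobi sum up to scaling, minus
the same line sum ([appellF3_split], [jacobi_scaled]).  Solving for the line sum
yields the second term on the right and the product of binomials. *)

Set Implicit Arguments.
Unset Strict Implicit.
Unset Printing Implicit Defensive.

(** * Values of extended characters *)

Lemma ext_val (F : finFieldType) (chi : 'CF(unitsG F)) (w : {unit F}) :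
  ext chi (val w) = chi w.
Proof. by rewrite /ext valK. Qed.

Lemma neq0_unit (F : finFieldType) (x : F) :
  x != 0 -> exists w : {unit F}, x = val w.
Proof. by move=> nz_x; exists (FinRing.unit F (etrans (unitfE x) nz_x)). Qed.

Lemma ext0 (F : finFieldType) (chi : 'CF(unitsG F)) : ext chi 0 = 0.
Proof. by rewrite /ext insubF // unitr0. Qed.

Lemma ext_trivial (F : finFieldType) (x : F) :
  ext (1 : 'CF(unitsG F)) x = (x != 0)%:R.
Proof.
have [->|/neq0_unit[w ->]] := eqVneq x 0; first by rewrite ext0.
by rewrite ext_val cfun1E inE.
Qed.

Lemma ext_mul (F : finFieldType) (chi psi : 'CF(unitsG F)) (x : F) :
  ext (chi * psi) x = ext chi x * ext psi x.
Proof.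
have [->|/neq0_unit[w ->]] := eqVneq x 0; first by rewrite !ext0 mul0r.
by rewrite !ext_val cfunE.
Qed.

Lemma ext_neq0 (F : finFieldType) (chi : 'CF(unitsG F)) (x : F) :
  chi \is a linear_char -> x != 0 -> ext chi x != 0.
Proof.
by move=> lin_chi /neq0_unit[w ->]; rewrite ext_val lin_char_neq0 ?inE.
Qed.

(** No case distinction at 0 is needed in this lemma and in [extM] and [extV]:
both sides vanish there, since [0^-1 = 0]. *)
Lemma ext_inv (F : finFieldType) (chi : 'CF(unitsG F)) (x : F) :
  chi \is a linear_char -> ext chi^-1 x = (ext chi x)^-1.
Proof.
move=> lin_chi; have [->|nz_x] := eqVneq x 0; first by rewrite !ext0 invr0.
apply: (mulfI (ext_neq0 lin_chi nz_x)).
by rewrite -ext_mul divrr ?lin_char_unitr // ext_trivial nz_x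
           mulfV ?ext_neq0.
Qed.

Lemma extM (F : finFieldType) (chi : 'CF(unitsG F)) (x y : F) :
  chi \is a linear_char -> ext chi (x * y) = ext chi x * ext chi y.
Proof.
move=> lin_chi; have [->|/neq0_unit[w ->]] := eqVneq x 0.
  by rewrite mul0r !ext0 mul0r.
have [->|/neq0_unit[z ->]] := eqVneq y 0; first by rewrite mulr0 !ext0 mulr0.
by rewrite -FinRing.val_unitM !ext_val lin_charM ?inE.
Qed.

Lemma ext1 (F : finFieldType) (chi : 'CF(unitsG F)) :
  chi \is a linear_char -> ext chi 1 = 1.
Proof.
move=> lin_chi; apply: (mulfI (ext_neq0 lin_chi (oner_neq0 F))).
by rewrite -extM // !mulr1.
Qed.

Lemma extV (F : finFieldType) (chi : 'CF(unitsG F)) (x : F) :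
  chi \is a linear_char -> ext chi x^-1 = (ext chi x)^-1.
Proof.
move=> lin_chi; have [->|nz_x] := eqVneq x 0; first by rewrite invr0 ext0 invr0.
apply: (mulfI (ext_neq0 lin_chi nz_x)).
by rewrite -extM // !mulfV ?ext1 ?ext_neq0.
Qed.

Lemma ext_N1 (F : finFieldType) (chi : 'CF(unitsG F)) :
  chi \is a linear_char -> ext chi (-1) = 1 \/ ext chi (-1) = -1.
Proof.
move=> lin_chi; have : ext chi (-1) ^+ 2 == 1.
  by rewrite expr2 -extM // mulrNN mulr1 ext1.
by rewrite sqrf_eq1 => /orP[] /eqP; [left | right].
Qed.

(** * Orthogonality and the binomial theorem *)

Lemma unitsG_abelian (F : finFieldType) : abelian (unitsG F).
Proof.
apply/centsP=> w _ z _; apply: val_inj.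
by rewrite !FinRing.val_unitM mulrC.
Qed.

Lemma card_unitsG (F : finFieldType) : #|unitsG F|%:R = #|F|%:R - 1 :> algC.
Proof.
have F_gt0 : (0 < #|F|)%N by rewrite ltnW // card_finNzRing_gt1.
by rewrite card_finField_unit -subn1 natrB.
Qed.

Lemma card_pred_neq0 (F : finFieldType) : #|F|%:R - 1 != 0 :> algC.
Proof. by rewrite -card_unitsG neq0CG. Qed.

(** Second orthogonality relation between [z] and 1: since [F^*] is abelian, all
its irreducible characters are linear and centralisers are the whole group. *)
Lemma sum_ext_lin_char (F : finFieldType) (z : F) :
  \sum_(theta <- irr (unitsG F) | theta \is a linear_char) ext theta z
    = (#|F|%:R - 1) *+ (z == 1).
Proof.
have irr_lin := char_abelianP _ (unitsG_abelian F).
rewrite big_tuple (eq_bigl xpredT) => [|i]; last exact: irr_lin.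
have [->|/neq0_unit[w ->]] := eqVneq z 0.
  by rewrite eq_sym oner_eq0 big1 // => i _; rewrite ext0.
have := second_orthogonality_relation w (group1 (unitsG F)).
rewrite class1G inE -[w == 1%g](inj_eq val_inj) -card_unitsG.
have ->: 'C_(unitsG F)[w]%g = unitsG F.
  apply/setIidPl/subsetP=> v _; apply/cent1P.
  by apply: (centsP (unitsG_abelian F)); rewrite inE.
move=> <-; apply: eq_bigr => i _.
by rewrite ext_val (lin_char1 (irr_lin i)) conjC1 mulr1.
Qed.

(** Expand [cbinom] as a sum over [w].  The sign [ext theta (-1)] combines with
the other factors into [ext theta (- w * z / (1 - w))], and orthogonality keeps
the [w] where this argument is 1.  The excluded value [w = 1] takes care of
itself: division by 0 gives 0, so the argument is then 0. *)
Lemma binomial_theorem (F : finFieldType) (D : 'CF(unitsG F)) (z : F) :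
    D \is a linear_char ->
  (#|F|%:R - 1)^-1 *
    (\sum_(theta <- irr (unitsG F) | theta \is a linear_char)
       cbinom (D * theta) theta * ext theta z)
  = (z != 0)%:R * ext D^-1 (1 - z).
Proof.
move=> lin_D.
have expand theta : theta \is a linear_char ->
    cbinom (D * theta) theta * ext theta z
      = \sum_w ext D w * ext theta ((-1) * w * z / (1 - w)).
  move=> lin_th; rewrite /cbinom /jacobi mulr_sumr mulr_suml.
  apply: eq_bigr => w _.
  by rewrite ext_mul ext_inv // !extM // extV //; ring.
rewrite (eq_bigr _ expand) exchange_big mulr_sumr /=.
have pick w : (#|F|%:R - 1)^-1 *
    (\sum_(theta <- irr (unitsG F) | theta \is a linear_char)
       ext D w * ext theta ((-1) * w * z / (1 - w)))
    = ext D w *+ ((-1) * w * z / (1 - w) == 1).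
  rewrite -mulr_sumr sum_ext_lin_char mulrCA mulrnAr mulVf ?card_pred_neq0 //.
  by rewrite mulrnAr mulr1.
rewrite (eq_bigr _ (fun w _ => pick w)) {expand pick}.
have [->|nz_z] := eqVneq z 0.
  rewrite mul0r big1 // => w _.
  by rewrite mulr0 mul0r eq_sym oner_eq0.
have solve w : ((-1) * w * z / (1 - w) == 1) = (w * (1 - z) == 1).
  have [->|w_neq1] := eqVneq w 1.
    rewrite subrr invr0 mulr0 mul1r eq_sym oner_eq0.
    by rewrite -[RHS]subr_eq0 addrAC subrr add0r oppr_eq0 (negPf nz_z).
  rewrite -(inj_eq (mulIf (_ : 1 - w != 0))) ?subr_eq0 1?eq_sym //.
  rewrite divfK ?subr_eq0 1?eq_sym // mul1r.
  rewrite -[LHS]subr_eq0 -[RHS]subr_eq0; congr (_ == 0); ring.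
rewrite mul1r.
have [z1|nz_1z] := eqVneq (1 - z) 0.
  rewrite z1 ext0 big1 // => w _.
  by rewrite solve z1 mulr0 eq_sym oner_eq0.
rewrite (bigD1 (1 - z)^-1) //= solve mulVf // eqxx extV // ext_inv //.
rewrite big1 ?addr0 // => w w_neq; rewrite solve.
rewrite -(inj_eq (mulIf (invr_neq0 nz_1z))) mulfK // mul1r.
by rewrite (negPf w_neq).
Qed.

(** * Rewriting the Appell series *)

Lemma jacobi_scaled (F : finFieldType) (A B : 'CF(unitsG F)) (x : F) :
    B \is a linear_char -> x != 0 ->
  \sum_u ext B u * ext A (1 - u * x) = ext B^-1 x * jacobi A B.
Proof.
move=> lin_B nz_x.
have inj_h : injective (fun u : F => 1 - u * x).
  by move=> u v /addrI/oppr_inj/(mulIf nz_x).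
rewrite /jacobi [in RHS](reindex_inj inj_h) mulr_sumr.
apply: eq_bigr => u _ /=.
rewrite subKr extM // ext_inv //; field.
exact: ext_neq0.
Qed.

Lemma sum_line (F : finFieldType) (G : F -> F -> algC) :
  \sum_u \sum_v (1 - u - v == 0)%:R * G u v = \sum_v G (1 - v) v.
Proof.
rewrite exchange_big; apply: eq_bigr => v _ /=.
rewrite (bigD1 (1 - v)) //= subKr subrr eqxx mul1r.
rewrite big1 ?addr0 // => u u_neq.
have ->: 1 - u - v = 1 - v - u by ring.
by rewrite subr_eq0 eq_sym (negPf u_neq) mul0r.
Qed.

Lemma lin_char_divK (F : finFieldType) (B C : 'CF(unitsG F)) :
    B \is a linear_char -> C \is a linear_char ->
  (C^-1 * B)^-1 = C * B^-1.
Proof.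
move=> lin_B lin_C.
by rewrite invrM ?unitrV ?lin_char_unitr // invrK mulrC.
Qed.

(** The double sum of [appellF3 A A' B (C * B^-1) C x y], restricted to the line
[u + v = 1] and with the factor depending on [1 - u - v] dropped. *)
Definition line_sum (F : finFieldType) (A A' B C : 'CF(unitsG F)) (x y : F) :=
  \sum_v ext B (1 - v) * ext (C * B^-1) v * ext A^-1 (1 - (1 - v) * x)
    * ext A'^-1 (1 - v * y).

(** Twisting [B'] by [theta] multiplies the [(u, v)] term by
[ext theta (v / (1 - u - v))] and the prefactor by [ext theta (-1)].  Pulling
everything into the argument of [theta] prepares for [binomial_theorem].  Where
[1 - u - v = 0] the quotient is 0, in agreement with the vanishing term. *)
Lemma appellF3_mul_ext (F : finFieldType) (A A' B B' C theta : 'CF(unitsG F))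
    (x y t : F) :
    B' \is a linear_char -> theta \is a linear_char ->
  appellF3 A A' B (B' * theta) C x y * ext theta t
  = ext 1 (x * y) * ext (B * B') (-1) *
    \sum_u \sum_v
       ext B u * ext B' v * ext (C * B^-1 * B'^-1) (1 - u - v) *
       ext A^-1 (1 - u * x) * ext A'^-1 (1 - v * y) *
       ext theta ((-1) * v * t / (1 - u - v)).
Proof.
move=> lin_B' lin_th.
rewrite /appellF3 mulrA (ext_mul _ theta) mulrA.
rewrite -2!mulrA mulr_suml mulr_sumr; congr (_ * _).
apply: eq_bigr => u _; rewrite mulr_suml mulr_sumr; apply: eq_bigr => v _.
rewrite !(ext_mul, extM) // (extV _ lin_th).
rewrite (@ext_inv _ (B' * theta)) ?rpredM // (@ext_inv _ B') // ext_mul invfM.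
ring.
Qed.

Lemma appellF3_scale (F : finFieldType) (A A' B B' C : 'CF(unitsG F))
    (x y r : F) :
    B' \is a linear_char -> r != 0 ->
  ext B'^-1 r * appellF3 A A' B B' C x (y / r)
  = ext 1 (x * y) * ext (B * B') (-1) *
    \sum_u \sum_v
       ext B u * ext B' v * ext (C * B^-1 * B'^-1) (1 - u - v * r) *
       ext A^-1 (1 - u * x) * ext A'^-1 (1 - v * y).
Proof.
move=> lin_B' nz_r; rewrite /appellF3.
have ->: ext (1 : 'CF(unitsG F)) (x * (y / r)) = ext 1 (x * y).
  by rewrite !ext_trivial !mulf_eq0 invr_eq0 (negPf nz_r) orbF.
rewrite mulrCA mulr_sumr; congr (_ * _); apply: eq_bigr => u _.
rewrite [in LHS](reindex_inj (mulIf nz_r)) mulr_sumr; apply: eq_bigr => v _ /=.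
have ->: v * r * (y / r) = v * y by field.
rewrite extM // ext_inv //; field.
exact: ext_neq0.
Qed.

(** With [D = B * B' * C^-1], [s = 1 - u - v] and [z = - v * t / s],
multiplicativity combines the
factor [ext D^-1 s] of the series and the value [ext D^-1 (1 - z)] given by the
binomial theorem into [ext D^-1 (s + v * t)].  This is valid for [s] and [v]
nonzero.  For [v = 0] all terms vanish; for [s = 0] the left-hand term vanishes
but the combined one need not, hence the correction by [line_sum]. *)
Lemma sum_binom_appellF3 (F : finFieldType) (A A' B B' C : 'CF(unitsG F))
    (x y t : F) :
    B \is a linear_char -> B' \is a linear_char -> C \is a linear_char ->
    t != 0 ->
  (#|F|%:R - 1)^-1 *
    (\sum_(theta <- irr (unitsG F) | theta \is a linear_char)
       cbinom (B * B' * C^-1 * theta) theta *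
       appellF3 A A' B (B' * theta) C x y * ext theta t)
  = ext 1 (x * y) * ext (B * B') (-1) *
    (\sum_u \sum_v
       ext B u * ext B' v * ext (C * B^-1 * B'^-1) (1 - u - v * (1 - t)) *
       ext A^-1 (1 - u * x) * ext A'^-1 (1 - v * y)
     - ext (C * B^-1 * B'^-1) t * line_sum A A' B C x y).
Proof.
move=> lin_B lin_B' lin_C nz_t.
have lin_D : B * B' * C^-1 \is a linear_char by rewrite !(rpredM, rpredV).
have DV : (B * B' * C^-1)^-1 = C * B^-1 * B'^-1.
  by rewrite !invrM ?unitrM ?unitrV ?lin_char_unitr // invrK mulrA mulrAC.
move: DV; set E := C * B^-1 * B'^-1 => DV.
have lin_E : E \is a linear_char by rewrite !(rpredM, rpredV).
(* Move the sum over [theta] innermost. *)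
under eq_bigr => theta lin_th.
  rewrite -mulrA appellF3_mul_ext // mulrCA -/E mulr_sumr.
  under eq_bigr => u _ do [rewrite mulr_sumr;
    under eq_bigr => v _ do rewrite mulrCA].
  over.
rewrite -mulr_sumr mulrCA exchange_big mulr_sumr /=; congr (_ * _).
pose G u v : algC := ext B u * ext B' v * ext E (1 - u - v * (1 - t)) *
  ext A^-1 (1 - u * x) * ext A'^-1 (1 - v * y).
transitivity (\sum_u \sum_v (G u v - (1 - u - v == 0)%:R * G u v)).
  apply: eq_bigr => u _; rewrite exchange_big mulr_sumr /=.
  apply: eq_bigr => v _.
  rewrite -mulr_sumr mulrCA binomial_theorem // DV {}/G.
  have [s0|nz_s] := eqVneq (1 - u - v) 0.
    by rewrite s0 ext0 mulr0 !mul0r mul1r subrr.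
  rewrite mul0r subr0.
  have [->|nz_v] := eqVneq v 0; first by rewrite !ext0 mulr0 !mul0r.
  rewrite !mulf_eq0 oppr_eq0 oner_eq0 invr_eq0.
  rewrite (negPf nz_v) (negPf nz_t) (negPf nz_s) mul1r.
  have ->: 1 - u - v * (1 - t) = (1 - u - v) * (1 - (-1) * v * t / (1 - u - v)).
    by field.
  rewrite (extM _ _ lin_E); ring.
rewrite (eq_bigr _ (fun u _ => sumrB _ _ _ _)).
rewrite sumrB sum_line /line_sum mulr_sumr; congr (_ - _).
apply: eq_bigr => v _; rewrite /G.
(* On the line [u = 1 - v] the argument [s + v * t] reduces to [v * t]. *)
have ->: 1 - (1 - v) - v * (1 - t) = v * t by ring.
rewrite (extM _ _ lin_E) /E !ext_mul (ext_inv _ lin_B') (ext_inv _ lin_B).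
have [->|nz_v] := eqVneq v 0; first by rewrite !ext0 !(mulr0, mul0r).
rewrite (ext_inv _ lin_B') (ext_inv _ lin_B); field.
by rewrite !ext_neq0.
Qed.

(** The character [C * B^-1 * (C * B^-1)^-1] is trivial, so its value at
[1 - u - v] is 1 minus the indicator of the line [u + v = 1]; without that
indicator the variables [u] and [v] separate. *)
Lemma appellF3_split (F : finFieldType) (A A' B C : 'CF(unitsG F))
    (x y : F) :
    B \is a linear_char -> C \is a linear_char ->
  appellF3 A A' B (C * B^-1) C x y
  = ext 1 (x * y) * ext C (-1) *
    ((\sum_u ext B u * ext A^-1 (1 - u * x)) *
     (\sum_v ext (C * B^-1) v * ext A'^-1 (1 - v * y))
     - line_sum A A' B C x y).
Proof.
move=> lin_B lin_C; rewrite /appellF3.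
have ->: B * (C * B^-1) = C by rewrite mulrC divrK ?lin_char_unitr.
rewrite divrr ?unitrM ?unitrV ?lin_char_unitr //; congr (_ * _).
pose G u v : algC := ext B u * ext (C * B^-1) v * ext A^-1 (1 - u * x)
  * ext A'^-1 (1 - v * y).
rewrite -[line_sum _ _ _ _ _ _]/(\sum_v G (1 - v) v) -sum_line.
rewrite mulr_suml -sumrB; apply: eq_bigr => u _.
rewrite mulr_sumr -sumrB; apply: eq_bigr => v _.
by rewrite ext_trivial /G; case: eqVneq => _ /=; ring.
Qed.

Theorem theorem4p4 (F : finFieldType) (A A' B B' C : 'CF(unitsG F))
    (hA : A \is a linear_char) (hA' : A' \is a linear_char)
    (hB : B \is a linear_char) (hB' : B' \is a linear_char)
    (hC : C \is a linear_char)
    (x y t : F) (hy0 : y != 0) (hy1 : y != 1) (ht0 : t != 0) (ht1 : t != 1) :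
  (#|F|%:R - 1)^-1 *
    (\sum_(theta <- irr (unitsG F) | theta \is a linear_char)
       cbinom (B * B' * C^-1 * theta) theta *
       appellF3 A A' B (B' * theta) C x y * ext theta t)
  = ext B'^-1 (1 - t) * appellF3 A A' B B' C x (y / (1 - t))
    + ext (B^-1 * B'^-1 * C) (- t) * appellF3 A A' B (C * B^-1) C x y
    - ext B^-1 x * ext B'^-1 (- t) * ext (C^-1 * B) (- (y / t)) *
      cbinom A'^-1 (C^-1 * B) * cbinom A^-1 B^-1.
Proof.
rewrite sum_binom_appellF3 // appellF3_scale ?subr_eq0 1?eq_sym //.
rewrite appellF3_split //.
(* At [x = 0] every term vanishes; for [x] nonzero the single sums scale. *)
have [->|nz_x] := eqVneq x 0; first by rewrite mul0r !ext0; ring.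
rewrite !jacobi_scaled ?rpredM ?rpredV //.
rewrite /cbinom lin_char_divK // invrK.
rewrite ext_trivial mulf_eq0 (negPf nz_x) (negPf hy0) /=.
rewrite (@ext_inv _ (C * B^-1)) ?rpredM ?rpredV //.
move: (\sum_u _) (line_sum _ _ _ _ _ _) (jacobi _ _) (jacobi _ _) => S L J1 J2.
rewrite -(mulN1r t) -(mulN1r (y / t)) !ext_mul !ext_inv // !extM // !extV //.
have [nzBx nzCy nzBy] :
  [/\ ext B x != 0, ext C y != 0 & ext B y != 0] by rewrite !ext_neq0.
have [nzCt nzBt nzB't] :
  [/\ ext C t != 0, ext B t != 0 & ext B' t != 0] by rewrite !ext_neq0.
(* Both sides are now rational in the values of the characters; the values at
   -1 enter with different exponents, and agree because they are signs. *)
have [->|->] := ext_N1 hB; have [->|->] := ext_N1 hB';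
  have [->|->] := ext_N1 hC; field;
  by rewrite ?nzBx ?nzCy ?nzBy ?nzCt ?nzBt ?nzB't.
Qed.
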